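(* Let $n$ be a prime. There exist positive integers $x,y,z$ with $$\frac{4}{n}=\frac1x+\frac1y+\frac1z \qquad (\ast)$$ if and only if at least one of the following holds: (A) there exist positive integers $a,d,z$ with $d\mid a^2$ and $(4a-1)z-n(d+a)=0$; (B) there exist positive integers $a,d,z$ with $d\mid a^2$ and $(4a-1)z-d-na=0$. Moreover, if $(a,d,z)$ is as in (A), then $x=an$, $y=az/d$ and $z$ are positive integers satisfying $(\ast)$; and if $(a,d,z)$ is as in (B), then $x=an$, $y=naz/d$ and $z$ are positive integers satisfying $(\ast)$. *)

(* Defs.v *)
From HB Require Import structures.
From mathcomp Require Import all_boot all_order all_algebra.

Set Implicit Arguments.
Unset Strict Implicit.
Unset Printing Implicit Defensive.

Import Order.TTheory GRing.Theory Num.Theory.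

Local Open Scope ring_scope.

Definition is_solution (n x y z : nat) : Prop :=
  [/\ (0 < x)%N, (0 < y)%N, (0 < z)%N
    & 4%:R / n%:R = x%:R^-1 + y%:R^-1 + z%:R^-1 :> rat].

(* The equations are stated in [int], so that no subtraction is truncated. *)
Definition condA (n a d z : nat) : Prop :=
  [/\ (0 < a)%N, (0 < d)%N, (0 < z)%N, (d %| a ^ 2)%N
    & (4 * a%:Z - 1) * z%:Z - n%:Z * (d%:Z + a%:Z) = 0].

Definition condB (n a d z : nat) : Prop :=
  [/\ (0 < a)%N, (0 < d)%N, (0 < z)%N, (d %| a ^ 2)%N
    & (4 * a%:Z - 1) * z%:Z - d%:Z - n%:Z * a%:Z = 0].

(* Main.v *)
(** Clear denominators: 4xyz = n(xy + xz + yz).  If n is odd, n divides one of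
    x, y, z, and it cannot divide all three since 4 > 3.  If it divides only
    x = an, put y = gu, z = gv with u and v coprime: then uv is coprime to
    n(u + v), hence divides a, and d = az/y = av/u gives (A).  If it divides
    exactly x = an and y = bn, then b | az and z | ab, and d = az/b, a divisor
    of a^2 with cofactor ab/z, gives (B). *)
Require Import Defs.
From HB Require Import structures.
From mathcomp Require Import all_boot all_order all_algebra.
From mathcomp Require Import zify ring.

Set Implicit Arguments.
Unset Strict Implicit.

Lemma is_solutionP (n x y z : nat) : 0 < n ->
  is_solution n x y z <->
  [/\ 0 < x, 0 < y, 0 < z
    & 4 * (x * y * z) = n * (x * y + x * z + y * z)].
Proof.
move=> n0.
suff E : 0 < x -> 0 < y -> 0 < z ->
    (4%:R / n%:R = x%:R^-1 + y%:R^-1 + z%:R^-1 :> rat)%R <->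
    4 * (x * y * z) = n * (x * y + x * z + y * z).
  by split=> -[x0 y0 z0 h]; split=> //; apply/E.
move=> x0 y0 z0.
have nz m : 0 < m -> (m%:R != 0 :> rat)%R by rewrite Num.Theory.pnatr_eq0 -lt0n.
have -> : (x%:R^-1 + y%:R^-1 + z%:R^-1 =
    (x * y + x * z + y * z)%:R / (x * y * z)%:R :> rat)%R.
  rewrite !GRing.natrD !GRing.natrM; field.
  by rewrite !nz.
have xyz0 : 0 < x * y * z by rewrite !muln_gt0 x0 y0.
split=> [/eqP|h].
  rewrite GRing.eqr_div ?nz // -!GRing.natrM Num.Theory.eqr_nat => /eqP ->.
  exact: mulnC.
apply/eqP; rewrite GRing.eqr_div ?nz // -!GRing.natrM Num.Theory.eqr_nat h.
by rewrite mulnC.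
Qed.

Lemma condAP (n a d z : nat) :
  condA n a d z <->
  [/\ 0 < a, 0 < d, 0 < z, d %| a ^ 2 & 4 * (a * z) = n * (d + a) + z].
Proof. by split=> -[a0 d0 z0 da h]; split=> //; lia. Qed.

Lemma condBP (n a d z : nat) :
  condB n a d z <->
  [/\ 0 < a, 0 < d, 0 < z, d %| a ^ 2 & 4 * (a * z) = d + n * a + z].
Proof. by split=> -[a0 d0 z0 da h]; split=> //; lia. Qed.

(** The consecutive numbers [4 * a - 1] and [4 * a] are coprime, so [4 * a - 1] is coprime to [a],
    to its square and to every divisor of that square. *)
Lemma coprime_4a_sub1 (a d : nat) : 0 < a -> d %| a ^ 2 -> coprime d (4 * a - 1).
Proof.
move=> a0 /coprime_dvdl; apply; rewrite coprimeXl //.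
have e : 4 * a = (4 * a - 1).+1 by lia.
have : coprime (4 * a) (4 * a - 1) by rewrite {1}e coprimeSn.
by rewrite coprimeMl => /andP[].
Qed.

(* Modulo d, the hypothesis reads a(4a - 1)z = m a^2 = 0. *)
Lemma dvdn_az (m a d z k : nat) : 0 < a -> d %| a ^ 2 ->
  4 * (a * z) = k * d + m * a + z -> d %| a * z.
Proof.
move=> a0 da h; rewrite -(Gauss_dvdr _ (coprime_4a_sub1 a0 da)).
have -> : (4 * a - 1) * (a * z) = a * k * d + m * a ^ 2 by nia.
by apply: dvdn_add; apply: dvdn_mull.
Qed.

(** Write az = yd. Multiplying 4az = n(d + a) + z by ny and replacing yd by az gives the cleared
    equation for x = an. *)
Lemma condA_solution (n a d z : nat) : 0 < n -> condA n a d z ->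
  d %| a * z /\ is_solution n (a * n) (a * z %/ d) z.
Proof.
move=> n0 /condAP[a0 d0 z0 da h].
have daz : d %| a * z.
  by apply: (@dvdn_az n _ _ _ n) => //; rewrite h mulnDr.
split=> //; apply/is_solutionP => //.
have /dvdnP[y e] := daz; rewrite e mulnK //.
have y0 : 0 < y by have : 0 < y * d; [rewrite -e muln_gt0 a0|case: y {e}].
split=> //; first by rewrite muln_gt0 a0.
have -> : 4 * (a * n * y * z) = n * y * (4 * (a * z)) by ring.
rewrite h.
have -> : n * (a * n * y + a * n * z + y * z) =
  n * (a * n * y + n * (a * z) + y * z) by ring.
by rewrite e; ring.
Qed.

(** Again az = yd, but the second denominator is now ny, so 4az = d + na + z is multiplied by n^2
    y. *)
Lemma condB_solution (n a d z : nat) : 0 < n -> condB n a d z ->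
  d %| n * a * z /\ is_solution n (a * n) (n * a * z %/ d) z.
Proof.
move=> n0 /condBP[a0 d0 z0 da h].
have daz : d %| a * z.
  by apply: (@dvdn_az n _ _ _ 1) => //; rewrite mul1n.
split; first by rewrite -mulnA dvdn_mull.
apply/is_solutionP => //.
have /dvdnP[y e] := daz; rewrite -mulnA e mulnA mulnK //.
have y0 : 0 < y by have : 0 < y * d; [rewrite -e muln_gt0 a0|case: y {e}].
split=> //; rewrite ?muln_gt0 ?a0 ?n0 //.
have -> : 4 * (a * n * (n * y) * z) = n * n * y * (4 * (a * z)) by ring.
rewrite h.
have -> : n * (a * n * (n * y) + a * n * z + n * y * z) =
  n * n * (a * n * y + a * z + y * z) by ring.
by rewrite e; ring.
Qed.

Lemma one_multiple_condA (n x y z : nat) : prime n ->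
  0 < x -> 0 < y -> 0 < z ->
  4 * (x * y * z) = n * (x * y + x * z + y * z) ->
  n %| x -> ~~ (n %| y) -> ~~ (n %| z) -> exists a d z, condA n a d z.
Proof.
move=> np x0 y0 z0 h /dvdnP[a ex]; subst x; move=> ny nz.
have n0 := prime_gt0 np.
have a0 : 0 < a by move: x0; rewrite muln_gt0 => /andP[].
have [g [u [v [g0 cuv ey ez]]]] : exists g u v,
    [/\ 0 < g, coprime u v, y = u * g & z = v * g].
  have g0 : 0 < gcdn y z by rewrite gcdn_gt0 y0.
  have /dvdnP[u ey] := dvdn_gcdl y z; have /dvdnP[v ez] := dvdn_gcdr y z.
  exists (gcdn y z), u, v; split=> //.
  by rewrite /coprime -(eqn_pmul2r g0) mul1n muln_gcdl -ey -ez.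
move: ny nz h y0 z0; rewrite {}ey {}ez.
rewrite !(Euclid_dvdM _ _ np) !negb_or => /andP[nu _] /andP[nv _] h.
rewrite !muln_gt0 => /andP[u0 _] /andP[v0 _].
(* The cleared equation divided by ng. *)
have {}h : 4 * (a * g * (u * v)) = n * a * (u + v) + g * (u * v).
  apply/eqP; rewrite -(@eqn_pmul2l (n * g)) ?muln_gt0 ?n0 //; apply/eqP.
  by move: h; lia.
(* The prime n divides neither u nor v, and u + v shares no factor with u or v because these are
   coprime. *)
have cop : coprime (u * v) (n * (u + v)).
  rewrite coprimeMl !coprimeMr ![coprime _ n]coprime_sym !(prime_coprime _ np).
  rewrite nu nv /coprime gcdnDl gcdnDr.
  by rewrite [gcdn v u]gcdnC andbb.
(* Modulo uv the reduced equation reads n(u + v)a = 0. *)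
have /dvdnP[k ea] : u * v %| a.
  rewrite -(Gauss_dvdr _ cop) -(dvdn_addl (n := g * (u * v)));
    last exact: dvdn_mull.
  have -> : n * (u + v) * a + g * (u * v) = 4 * (a * g * (u * v)).
    by rewrite h; ring.
  by rewrite !mulnA -mulnA dvdn_mull.
have k0 : 0 < k by move: a0; rewrite ea muln_gt0 => /andP[].
(* Since a = kuv, the witness d = av/u is v^2 k, and its cofactor in a^2 is u^2 k. *)
exists a, (v * v * k), (v * g); apply/condAP; split=> //.
- by rewrite !muln_gt0 v0.
- by rewrite muln_gt0 v0.
- by apply/dvdnP; exists (u * u * k); rewrite ea; ring.
apply/eqP; rewrite -(@eqn_pmul2l u) //; apply/eqP.
have -> : u * (4 * (a * (v * g))) = 4 * (a * g * (u * v)) by ring.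
by rewrite h ea; ring.
Qed.

Lemma two_multiples_condB (n x y z : nat) : prime n ->
  0 < x -> 0 < y -> 0 < z ->
  4 * (x * y * z) = n * (x * y + x * z + y * z) ->
  n %| x -> n %| y -> ~~ (n %| z) -> exists a d z, condB n a d z.
Proof.
move=> np x0 y0 z0 h /dvdnP[a ex] /dvdnP[b ey] nz; subst x y.
have n0 := prime_gt0 np.
have a0 : 0 < a by move: x0; rewrite muln_gt0 => /andP[].
have b0 : 0 < b by move: y0; rewrite muln_gt0 => /andP[].
(* The cleared equation divided by n^2. It is read modulo b, where az = 0, and then modulo z, where
   nab = 0 with n invertible. *)
have {}h : 4 * (a * b * z) = n * (a * b) + a * z + b * z.
  apply/eqP; rewrite -(@eqn_pmul2l (n * n)) ?muln_gt0 ?n0 //; apply/eqP.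
  by move: h; lia.
have /dvdnP[d ed] : b %| a * z.
  rewrite -(dvdn_addl (n := (n * a + z) * b)); last exact: dvdn_mull.
  have -> : a * z + (n * a + z) * b = 4 * (a * b * z) by rewrite h; ring.
  by rewrite mulnA dvdn_mulr // mulnA dvdn_mull.
have /dvdnP[c ec] : z %| a * b.
  have cz : coprime z n by rewrite coprime_sym prime_coprime.
  rewrite -(Gauss_dvdr _ cz) -(dvdn_addl (n := (a + b) * z)); last exact: dvdn_mull.
  have -> : n * (a * b) + (a + b) * z = 4 * (a * b * z) by rewrite h; ring.
  by rewrite mulnA dvdn_mull.
have d0 : 0 < d.
  by have : 0 < d * b; [rewrite -ed muln_gt0 a0|rewrite muln_gt0 => /andP[]].
exists a, d, z; apply/condBP; split=> //.
  (* From az = db and ab = cz, the product of the two gives a^2 bz = cd bz. *)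
  apply/dvdnP; exists c; apply/eqP.
  rewrite -(@eqn_pmul2r (b * z)) ?muln_gt0 ?b0 //; apply/eqP.
  have -> : a ^ 2 * (b * z) = (a * b) * (a * z) by ring.
  by rewrite ed ec; ring.
apply/eqP; rewrite -(@eqn_pmul2l b) //; apply/eqP.
have -> : b * (4 * (a * z)) = 4 * (a * b * z) by ring.
by rewrite h ed; ring.
Qed.

(** A positive multiple of n is at least n, so each of the three terms on the right is at most xyz,
    whence 4xyz <= 3xyz. *)
Lemma not_three_multiples (n x y z : nat) : 0 < n ->
  0 < x -> 0 < y -> 0 < z ->
  4 * (x * y * z) = n * (x * y + x * z + y * z) ->
  n %| x -> n %| y -> n %| z -> False.
Proof.
move=> n0 x0 y0 z0 h nx ny nz.
have lx := dvdn_leq x0 nx; have ly := dvdn_leq y0 ny; have lz := dvdn_leq z0 nz.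
have h1 : n * (x * y) <= x * y * z by rewrite mulnC leq_mul2l lz orbT.
have h2 : n * (x * z) <= x * y * z by rewrite mulnAC mulnC leq_mul2l ly orbT.
have h3 : n * (y * z) <= x * y * z by rewrite -mulnA leq_mul2r lx orbT.
have : 0 < x * y * z by rewrite !muln_gt0 x0 y0.
by lia.
Qed.

Lemma solution_condA_or_condB (n x y z : nat) : prime n -> is_solution n x y z ->
  (exists a d z, condA n a d z) \/ (exists a d z, condB n a d z).
Proof.
move=> np /(is_solutionP _ _ _ (prime_gt0 np))[x0 y0 z0 h].
(* For n = 2 the factor 4 absorbs n and nothing follows about x, y, z; here (B) holds outright, as 4
   = 1 + 2 + 1. *)
have [->|n2] := eqVneq n 2; first by right; exists 1, 1, 1; apply/condBP.
have : n %| 4 * (x * y * z) by rewrite h dvdn_mulr.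
rewrite Euclid_dvdM //.
have -> : (n %| 4) = false.
  by rewrite (_ : 4 = 2 ^ 2) // Euclid_dvdX // dvdn_prime2 // (negbTE n2).
rewrite /= !Euclid_dvdM //.
(* The equation is symmetric; these permuted forms let the multiples of n be listed first in each
   case. *)
have hyxz : 4 * (y * x * z) = n * (y * x + y * z + x * z) by move: h; lia.
have hzxy : 4 * (z * x * y) = n * (z * x + z * y + x * y) by move: h; lia.
have hxzy : 4 * (x * z * y) = n * (x * z + x * y + z * y) by move: h; lia.
have hyzx : 4 * (y * z * x) = n * (y * z + y * x + z * x) by move: h; lia.
case: (boolP (n %| x)) => nx; case: (boolP (n %| y)) => ny;
  case: (boolP (n %| z)) => nz //= _.
- by case: (not_three_multiples (prime_gt0 np) x0 y0 z0 h nx ny nz).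
- by right; apply: (two_multiples_condB np x0 y0 z0 h).
- by right; apply: (two_multiples_condB np x0 z0 y0 hxzy).
- by left; apply: (one_multiple_condA np x0 y0 z0 h).
- by right; apply: (two_multiples_condB np y0 z0 x0 hyzx).
- by left; apply: (one_multiple_condA np y0 x0 z0 hyxz).
- by left; apply: (one_multiple_condA np z0 x0 y0 hzxy).
Qed.

Theorem theorem1 (n : nat) (n_prime : prime n) :
  [/\ (exists x y z : nat, is_solution n x y z) <->
        (exists a d z : nat, condA n a d z) \/
        (exists a d z : nat, condB n a d z),
      forall a d z : nat, condA n a d z ->
        d %| a * z /\ is_solution n (a * n) (a * z %/ d) z
    & forall a d z : nat, condB n a d z ->
        d %| n * a * z /\ is_solution n (a * n) (n * a * z %/ d) z].
Proof.
have n0 := prime_gt0 n_prime.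
split; last 2 first.
- by move=> a d z; apply: condA_solution.
- by move=> a d z; apply: condB_solution.
split=> [[x [y [z]]]|]; first exact: solution_condA_or_condB.
case=> -[a [d [z /[dup] c]]].
  by move/(condA_solution n0) => -[_ s]; exists (a * n), (a * z %/ d), z.
by move/(condB_solution n0) => -[_ s]; exists (a * n), (n * a * z %/ d), z.
Qed.
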